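(* Let $P$ be an $n$-ary predicate symbol and $\psi$ a formula with exactly $n$ free variables. If a sequent $\Gamma\Rightarrow\Delta$ is derivable in $\mathbf{G}(\mathsf{FBInqBQ})$ without applying the rule $(\Rightarrow\mathtt{at})$, then $\Gamma^{\psi}_{P}\Rightarrow\Delta^{\psi}_{P}$ is also derivable in $\mathbf{G}(\mathsf{FBInqBQ})$ without applying $(\Rightarrow\mathtt{at})$. Therefore, if for some $n\ge 1$ the sequent $\Rightarrow\{1,\dots,n\}:\varphi$ is derivable in $\mathbf{G}(\mathsf{FBInqBQ})$ without applying $(\Rightarrow\mathtt{at})$, then $\varphi$ is schematically valid in $\mathsf{InqBQ}_n$.
   Context: Language: countably infinite set $\mathsf{Var}$ of variables, countably infinite set $\mathsf{Pred}$ of predicate symbols with arities (no identity, constants, function symbols). Formulas: $\varphi ::= P(x_1,\dots,x_m)\mid \bot\mid \varphi\to\varphi\mid\varphi\wedge\varphi\mid \varphi\veebar\varphi\mid \forall x\varphi\mid \bar\exists x\varphi$ ($\veebar$ inquisitive disjunction, $\bar\exists$ inquisitive existential). $\varphi[z/x]$ is capture-avoiding substitution. Semantics: a relational information model $\mathfrak M=(W,D,\mathfrak I)$ has nonempty $W$, nonempty $D$, $\mathfrak I(P,w)\subseteq D^m$; for states $s\subseteq W$ and $g:\mathsf{Var}\to D$: $s\Vdash_g P(\bar x)$ iff $g(\bar x)\in\mathfrak I(P,w)$ for all $w\in s$; $s\Vdash_g\bot$ iff $s=\varnothing$; $\wedge$ pointwise; $s\Vdash_g\varphi\to\psi$ iff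 every $t\subseteq s$ supporting $\varphi$ supports $\psi$; $s\Vdash_g\varphi\veebar\psi$ iff $s\Vdash_g\varphi$ or $s\Vdash_g\psi$; $\forall x$ / $\bar\exists x$: for all / some $d\in D$, $s\Vdash_{g[x\mapsto d]}\varphi$. $\mathsf{InqBQ}_n$: formulas supported at all states under all assignments in all models with $|W|\le n$. Substitution: if $P$ is $n$-ary, $P(\bar a_1),\dots,P(\bar a_k)$ are all occurrences of $P$ in $\varphi$, and $\psi=\psi(\bar y)$ has exactly $n$ free variables, then $(\varphi)^{\psi}_P$ is obtained by replacing each $P(\bar a_i)$ by $\psi(\bar a_i)$, after renaming bound variables of $\psi$ so that no variable of $\bar a_i$ gets captured. $\varphi$ is schematically valid in $\mathsf{InqBQ}_n$ if every formula obtained from $\varphi$ by finitely many such substitutions belongs to $\mathsf{InqBQ}_n$. For labelled formulas $(X:\varphi)^\psi_P:=X:(\varphi)^\psi_P$, and $\Gamma^\psi_P$ applies this to each member of $\Gamma$. Calculus $\mathbf{G}(\mathsf{FBInqBQ})$: a label is a nonempty finite subset of $\omega$; a labelled formula is $X:\varphi$ with $X$ a label; a sequent $\Gamma\Rightarrow\Delta$ is a pair of finite multisets of labelled formulas. $X,Y$ range over labels. Initial sequents: $(\mathtt{id})$ $X:P(\bar x),\Gamma\Rightarrow\Delta,Y:P(\bar x)$ whenever $X\supseteq Y$; $(\bot\Rightarrow)$ $X:\bot,\Gamma\Rightarrow\Delta$. Rules (premises / conclusion): $(\Rightarrow\mathtt{at})$: $\Gamma\Rightarrow\Delta,\{k\}:P(\bar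 x)$ for every $k\in X$ / $\Gamma\Rightarrow\Delta,X:P(\bar x)$. $(\Rightarrow\wedge)$: $\Gamma\Rightarrow\Delta,X:\varphi$ and $\Gamma\Rightarrow\Delta,X:\psi$ / $\Gamma\Rightarrow\Delta,X:\varphi\wedge\psi$. $(\wedge\Rightarrow)$: $X:\varphi,X:\psi,\Gamma\Rightarrow\Delta$ / $X:\varphi\wedge\psi,\Gamma\Rightarrow\Delta$. $(\Rightarrow\veebar)$: $\Gamma\Rightarrow\Delta,X:\varphi,X:\psi$ / $\Gamma\Rightarrow\Delta,X:\varphi\veebar\psi$. $(\veebar\Rightarrow)$: $X:\varphi,\Gamma\Rightarrow\Delta$ and $X:\psi,\Gamma\Rightarrow\Delta$ / $X:\varphi\veebar\psi,\Gamma\Rightarrow\Delta$. $(\Rightarrow\to)$: $Y:\varphi,\Gamma\Rightarrow\Delta,Y:\psi$ for every label $Y\subseteq X$ / $\Gamma\Rightarrow\Delta,X:\varphi\to\psi$. $(\to\Rightarrow)$, for a label $Y\subseteq X$: $X:\varphi\to\psi,\Gamma\Rightarrow\Delta,Y:\varphi$ and $Y:\psi,X:\varphi\to\psi,\Gamma\Rightarrow\Delta$ / $X:\varphi\to\psi,\Gamma\Rightarrow\Delta$. $(\Rightarrow\forall)$: $\Gamma\Rightarrow\Delta,X:\varphi[z/x]$ / $\Gamma\Rightarrow\Delta,X:\forall x\varphi$, with $z$ not occurring in the conclusion. $(\forall\Rightarrow)$: $X:\varphi[y/x],X:\forall x\varphi,\Gamma\Rightarrow\Delta$ / $X:\forall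 x\varphi,\Gamma\Rightarrow\Delta$ ($y$ arbitrary). $(\Rightarrow\bar\exists)$: $\Gamma\Rightarrow\Delta,X:\bar\exists x\varphi,X:\varphi[y/x]$ / $\Gamma\Rightarrow\Delta,X:\bar\exists x\varphi$ ($y$ arbitrary). $(\bar\exists\Rightarrow)$: $X:\varphi[z/x],\Gamma\Rightarrow\Delta$ / $X:\bar\exists x\varphi,\Gamma\Rightarrow\Delta$, with $z$ not occurring in the conclusion. A derivation is a finite tree of sequents built from initial sequents by these rules; a sequent is derivable if it is the root of a derivation. *)

(* Defs.v *)
From HB Require Import structures.
From mathcomp Require Import all_boot finmap multiset.

Set Implicit Arguments.
Unset Strict Implicit.
Unset Printing Implicit Defensive.

Local Open Scope fset_scope.

Record signature := Signature {
  predsym :> countType;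
  arity : predsym -> nat;
  predsym_infinite : forall s : seq predsym, exists P, P \notin s
}.

Definition var := nat.

Inductive formula (S : signature) : Type :=
| Atom (P : S) (xs : (arity P).-tuple var)
| Bot
| Imp (phi psi : formula S)
| Conj (phi psi : formula S)
| IDisj (phi psi : formula S)
| All (x : var) (phi : formula S)
| IEx (x : var) (phi : formula S).

Arguments Bot {S}.

(* The type {mset T} requires a choiceType, so formulas are given one by an
   encoding into generic trees. *)
Section FormulaCountable.
Variable S : signature.

Let atomic := {P : S & (arity P).-tuple var}.

Fixpoint formula_encode (phi : formula S) : GenTree.tree atomic :=
  match phi with
  | Atom P xs => GenTree.Leaf (Tagged (fun P : S => (arity P).-tuple var) xs)
  | Bot => GenTree.Node 0 [::]
  | Imp a b => GenTree.Node 1 [:: formula_encode a; formula_encode b]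
  | Conj a b => GenTree.Node 2 [:: formula_encode a; formula_encode b]
  | IDisj a b => GenTree.Node 3 [:: formula_encode a; formula_encode b]
  | All x a => GenTree.Node 4 [:: GenTree.Node x [::]; formula_encode a]
  | IEx x a => GenTree.Node 5 [:: GenTree.Node x [::]; formula_encode a]
  end.

Fixpoint formula_decode (t : GenTree.tree atomic) : option (formula S) :=
  match t with
  | GenTree.Leaf u => Some (Atom (tagged u))
  | GenTree.Node 0 [::] => Some Bot
  | GenTree.Node 1 [:: a; b] =>
      if (formula_decode a, formula_decode b) is (Some p, Some q)
      then Some (Imp p q) else None
  | GenTree.Node 2 [:: a; b] =>
      if (formula_decode a, formula_decode b) is (Some p, Some q)
      then Some (Conj p q) else None
  | GenTree.Node 3 [:: a; b] =>
      if (formula_decode a, formula_decode b) is (Some p, Some q)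
      then Some (IDisj p q) else None
  | GenTree.Node 4 [:: GenTree.Node x [::]; a] => omap (All x) (formula_decode a)
  | GenTree.Node 5 [:: GenTree.Node x [::]; a] => omap (IEx x) (formula_decode a)
  | _ => None
  end.

Lemma formula_encodeK : pcancel formula_encode formula_decode.
Proof. by elim=> //= [p -> q ->|p -> q ->|p -> q ->|x p ->|x p ->]. Qed.

HB.instance Definition _ := Countable.copy (formula S) (pcan_type formula_encodeK).

End FormulaCountable.

Section Syntax.
Variable S : signature.
Implicit Types (phi psi : formula S).

Fixpoint fv phi : {fset var} :=
  match phi with
  | Atom _ xs => [fset x in tval xs]
  | Bot => fset0
  | Imp a b | Conj a b | IDisj a b => fv a `|` fv b
  | All x a | IEx x a => fv a `\ x
  end.

(* All variables occurring in a formula: free, bound, or next to a quantifier. *)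
Fixpoint vars phi : {fset var} :=
  match phi with
  | Atom _ xs => [fset x in tval xs]
  | Bot => fset0
  | Imp a b | Conj a b | IDisj a b => vars a `|` vars b
  | All x a | IEx x a => x |` vars a
  end.

End Syntax.

Definition upd (T : Type) (g : var -> T) (x : var) (d : T) : var -> T :=
  fun y => if y == x then d else g y.

Definition fresh (A : {fset var}) : var := (\max_(x <- A) x).+1.

Section Substitution.
Variable S : signature.
Implicit Types (phi psi : formula S).

(* The name given to a binder [x] with body [phi] when [sigma] is pushed under
   it: [x] itself unless it would capture some [sigma y] with [y] free in the
   quantified formula. *)
Definition binder (sigma : var -> var) (x : var) phi : var :=
  let im := [fset sigma y | y in fv phi `\ x] in
  if x \in im then fresh im else x.

(* Simultaneous capture-avoiding substitution of variables for free variables. *)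
Fixpoint rename (sigma : var -> var) phi : formula S :=
  match phi with
  | Atom P xs => Atom (map_tuple sigma xs)
  | Bot => Bot
  | Imp a b => Imp (rename sigma a) (rename sigma b)
  | Conj a b => Conj (rename sigma a) (rename sigma b)
  | IDisj a b => IDisj (rename sigma a) (rename sigma b)
  | All x a => let z := binder sigma x a in All z (rename (upd sigma x z) a)
  | IEx x a => let z := binder sigma x a in IEx z (rename (upd sigma x z) a)
  end.

(* phi[z/x] *)
Definition subst1 phi (x z : var) : formula S := rename (upd id x z) phi.

(* [ys] lists the free variables of [psi] without repetition; in particular
   [psi] has exactly [n] free variables.  It fixes the reading psi = psi(ys). *)
Definition lists_fv (n : nat) (ys : n.-tuple var) psi : Prop :=
  uniq ys /\ [fset y in tval ys] = fv psi.

(* psi(as), for psi = psi(ys): variables outside [ys] are left unchanged. *)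
Definition apply_args psi (ys xs : seq var) : formula S :=
  rename (fun y => nth y xs (index y ys)) psi.

(* (phi)^psi_P, for psi = psi(ys) *)
Fixpoint psubst (P : S) (ys : (arity P).-tuple var) psi phi : formula S :=
  match phi with
  | Atom Q xs => if Q == P then apply_args psi ys xs else Atom xs
  | Bot => Bot
  | Imp a b => Imp (psubst ys psi a) (psubst ys psi b)
  | Conj a b => Conj (psubst ys psi a) (psubst ys psi b)
  | IDisj a b => IDisj (psubst ys psi a) (psubst ys psi b)
  | All x a => All x (psubst ys psi a)
  | IEx x a => IEx x (psubst ys psi a)
  end.

Inductive schematic_instance phi : formula S -> Prop :=
| instance_refl : schematic_instance phi phi
| instance_step chi (P : S) (ys : (arity P).-tuple var) psi :
    schematic_instance phi chi -> lists_fv ys psi ->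
    schematic_instance phi (psubst ys psi chi).

End Substitution.

Record model (S : signature) := Model {
  world : Type;
  indiv : Type;
  world_inhabited : inhabited world;
  indiv_inhabited : inhabited indiv;
  interp : forall P : S, world -> (arity P).-tuple indiv -> Prop
}.

Section Semantics.
Variable S : signature.

Fixpoint supports (M : model S) (s : world M -> Prop) (g : var -> indiv M)
    (phi : formula S) : Prop :=
  match phi with
  | Atom P xs => forall w, s w -> interp w (map_tuple g xs)
  | Bot => forall w, ~ s w
  | Imp a b => forall t : world M -> Prop, (forall w, t w -> s w) ->
      supports t g a -> supports t g b
  | Conj a b => supports s g a /\ supports s g b
  | IDisj a b => supports s g a \/ supports s g b
  | All x a => forall d, supports s (upd g x d) a
  | IEx x a => exists d, supports s (upd g x d) a
  end.

Definition InqBQ (n : nat) (phi : formula S) : Prop :=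
  forall M : model S, (exists f : world M -> 'I_n, injective f) ->
  forall (s : world M -> Prop) (g : var -> indiv M), supports s g phi.

Definition schematically_valid (n : nat) (phi : formula S) : Prop :=
  forall chi, schematic_instance phi chi -> InqBQ n chi.

End Semantics.

Record label := Label { lset :> {fset nat}; lset_neq0 : lset != fset0 }.
HB.instance Definition _ := [isSub for lset].
HB.instance Definition _ := [Choice of label by <:].

Lemma fset1_neq0 (k : nat) : [fset k] != fset0.
Proof. by apply/fset0Pn; exists k; rewrite inE. Qed.

Definition label1 (k : nat) : label := Label (fset1_neq0 k).

Lemma initial_neq0 (n : nat) : 0 < n -> [fset k in iota 1 n] != fset0.
Proof. by case: n => // n _; apply/fset0Pn; exists 1; rewrite !inE. Qed.

(* The label {1, ..., n}. *)
Definition initial_label (n : nat) (n_gt0 : 0 < n) : label :=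
  Label (initial_neq0 n_gt0).

Local Open Scope mset_scope.

Section Calculus.
Variable S : signature.

Definition lformula : Type := label * formula S.

Implicit Types (Gamma Delta : {mset lformula}) (X Y : label).
Implicit Types (phi psi : formula S).

Definition not_in (z : var) Gamma : Prop :=
  forall L : lformula, L \in Gamma -> z \notin vars L.2.

(* [derivable at_allowed Gamma Delta]: the sequent [Gamma => Delta] has a
   derivation, in which the rule (=> at) may be applied only if [at_allowed]. *)
Inductive derivable (at_allowed : bool) : {mset lformula} -> {mset lformula} -> Prop :=
| ax_id Gamma Delta X Y (P : S) (xs : (arity P).-tuple var) :
    (Y `<=` X)%fset ->
    derivable at_allowed ((X, Atom xs) +` Gamma) ((Y, Atom xs) +` Delta)
| ax_bot Gamma Delta X :
    derivable at_allowed ((X, Bot) +` Gamma) Delta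
| rule_at_r Gamma Delta X (P : S) (xs : (arity P).-tuple var) :
    at_allowed ->
    (forall k, k \in lset X ->
       derivable at_allowed Gamma ((label1 k, Atom xs) +` Delta)) ->
    derivable at_allowed Gamma ((X, Atom xs) +` Delta)
| rule_and_r Gamma Delta X phi psi :
    derivable at_allowed Gamma ((X, phi) +` Delta) ->
    derivable at_allowed Gamma ((X, psi) +` Delta) ->
    derivable at_allowed Gamma ((X, Conj phi psi) +` Delta)
| rule_and_l Gamma Delta X phi psi :
    derivable at_allowed ((X, phi) +` ((X, psi) +` Gamma)) Delta ->
    derivable at_allowed ((X, Conj phi psi) +` Gamma) Delta
| rule_or_r Gamma Delta X phi psi :
    derivable at_allowed Gamma ((X, phi) +` ((X, psi) +` Delta)) ->
    derivable at_allowed Gamma ((X, IDisj phi psi) +` Delta)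
| rule_or_l Gamma Delta X phi psi :
    derivable at_allowed ((X, phi) +` Gamma) Delta ->
    derivable at_allowed ((X, psi) +` Gamma) Delta ->
    derivable at_allowed ((X, IDisj phi psi) +` Gamma) Delta
| rule_imp_r Gamma Delta X phi psi :
    (forall Y, (Y `<=` X)%fset ->
       derivable at_allowed ((Y, phi) +` Gamma) ((Y, psi) +` Delta)) ->
    derivable at_allowed Gamma ((X, Imp phi psi) +` Delta)
| rule_imp_l Gamma Delta X Y phi psi :
    (Y `<=` X)%fset ->
    derivable at_allowed ((X, Imp phi psi) +` Gamma) ((Y, phi) +` Delta) ->
    derivable at_allowed ((Y, psi) +` ((X, Imp phi psi) +` Gamma)) Delta ->
    derivable at_allowed ((X, Imp phi psi) +` Gamma) Delta
| rule_all_r Gamma Delta X x z phi :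
    not_in z Gamma -> not_in z ((X, All x phi) +` Delta) ->
    derivable at_allowed Gamma ((X, subst1 phi x z) +` Delta) ->
    derivable at_allowed Gamma ((X, All x phi) +` Delta)
| rule_all_l Gamma Delta X x y phi :
    derivable at_allowed ((X, subst1 phi x y) +` ((X, All x phi) +` Gamma)) Delta ->
    derivable at_allowed ((X, All x phi) +` Gamma) Delta
| rule_ex_r Gamma Delta X x y phi :
    derivable at_allowed Gamma ((X, IEx x phi) +` ((X, subst1 phi x y) +` Delta)) ->
    derivable at_allowed Gamma ((X, IEx x phi) +` Delta)
| rule_ex_l Gamma Delta X x z phi :
    not_in z ((X, IEx x phi) +` Gamma) -> not_in z Delta ->
    derivable at_allowed ((X, subst1 phi x z) +` Gamma) Delta ->
    derivable at_allowed ((X, IEx x phi) +` Gamma) Delta.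

Definition derivable_without_at := derivable false.

(* Gamma^psi_P, preserving multiplicities *)
Definition psubst_mset (P : S) (ys : (arity P).-tuple var) psi Gamma :
    {mset lformula} :=
  seq_mset [seq (L.1, psubst ys psi L.2) | L : lformula <- Gamma].

End Calculus.

(* Main.v *)
From Stdlib Require Import Classical ClassicalEpsilon.
From HB Require Import structures.
Require Import Defs.
From mathcomp Require Import all_boot finmap multiset.

Set Implicit Arguments.
Unset Strict Implicit.
Unset Printing Implicit Defensive.

Local Open Scope fset_scope.
Local Open Scope mset_scope.

(* Without (=> at), the calculus only sees labels as points of a frame ordered by
   reverse inclusion: it is sound and complete for intuitionistic Kripke models on
   this frame with constant domain, where atoms have an arbitrary persistent
   valuation.  Completeness comes from a fair proof search, whose limit is a
   Hintikka pair of sets of labelled formulas.  Validity in these models is closed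
   under substitution of [psi] for [P], because "[X] forces [psi]" is itself
   persistent and may serve as the valuation of [P].  Finally, a nonempty state of
   a model with at most [n] worlds, its worlds being numbered by 1, ..., n, turns
   the frame into such a Kripke model, in which forcing at [X] is support at the
   set of worlds numbered in [X]. *)

(** Countability of labels lets [task_at] enumerate the demands of the proof search. *)
HB.instance Definition _ := [Countable of label by <:].

Lemma fresh_notin (A : {fset var}) : fresh A \notin A.
Proof.
apply/negP => fA; have := @leq_bigmax_seq _ _ xpredT id _ fA isT.
by rewrite /fresh ltnn.
Qed.

(** * Kripke semantics on labels *)

Section Forcing.
Variable S : signature.
Implicit Types (phi psi : formula S) (X Y Z : label).

Section FixedDomain.
Variable D : Type.
Implicit Types (V : S -> label -> seq D -> Prop) (g : var -> D).

(* Valuations take sequences of any length rather than [(arity P).-tuple]s, so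
   that [val_subst] below needs no transport along an equation [Q = P]. *)
Fixpoint forces V X g phi : Prop :=
  match phi with
  | Atom P xs => V P X (map g xs)
  | Bot => False
  | Imp a b => forall Y, (Y `<=` X)%fset -> forces V Y g a -> forces V Y g b
  | Conj a b => forces V X g a /\ forces V X g b
  | IDisj a b => forces V X g a \/ forces V X g b
  | All x a => forall d, forces V X (upd g x d) a
  | IEx x a => exists d, forces V X (upd g x d) a
  end.

Definition persistent V : Prop :=
  forall P X Y ds, (Y `<=` X)%fset -> V P X ds -> V P Y ds.

Lemma forces_persistent V phi X Y g :
  persistent V -> (Y `<=` X)%fset -> forces V X g phi -> forces V Y g phi.
Proof.
move=> pV; elim: phi X Y g => //=.
- by move=> P xs X Y g YX; apply: pV.
- by move=> a _ b _ X Y g YX ab Z ZY; apply: ab; apply: fsubset_trans YX.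
- by move=> a IHa b IHb X Y g YX [fa fb]; split; eauto.
- by move=> a IHa b IHb X Y g YX [fa|fb]; [left|right]; eauto.
- by move=> x a IHa X Y g YX fa d; eauto.
- by move=> x a IHa X Y g YX [d fa]; exists d; eauto.
Qed.

Lemma forces_eq_on V phi X g h :
  {in fv phi, g =1 h} -> forces V X g phi -> forces V X h phi.
Proof.
elim: phi X g h => //=.
- move=> P xs X g h gh.
  suff -> : map g xs = map h xs by [].
  by apply/eq_in_map => y yxs; apply: gh; rewrite !inE.
- move=> a IHa b IHb X g h gh ab Y YX fa.
  have gha : {in fv a, h =1 g} by move=> y ya; rewrite gh // inE ya.
  have ghb : {in fv b, g =1 h} by move=> y yb; rewrite gh // inE yb orbT.
  by apply: IHb ghb _; apply: ab => //; apply: IHa gha fa.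
- move=> a IHa b IHb X g h gh [fa fb]; split.
    by apply: IHa fa => y ya; rewrite gh // inE ya.
  by apply: IHb fb => y yb; rewrite gh // inE yb orbT.
- move=> a IHa b IHb X g h gh [fa|fb]; [left|right].
    by apply: IHa fa => y ya; rewrite gh // inE ya.
  by apply: IHb fb => y yb; rewrite gh // inE yb orbT.
- move=> x a IHa X g h gh fa d; apply: IHa (fa d) => y ya.
  by rewrite /upd; case: eqP => // /eqP yx; apply: gh; rewrite !inE yx.
- move=> x a IHa X g h gh [d fa]; exists d; apply: IHa fa => y ya.
  by rewrite /upd; case: eqP => // /eqP yx; apply: gh; rewrite !inE yx.
Qed.

Lemma binder_avoids (sigma : var -> var) x phi y :
  y \in fv phi -> y != x -> sigma y != binder sigma x phi.
Proof.
move=> ya yx; rewrite /binder /=; set im := [fset _ | _ in _].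
have sim : sigma y \in im by apply/imfsetP; exists y; rewrite //= !inE yx.
case: ifP => [_|/negP xim]; apply/eqP => e; last by rewrite -e in xim.
by have := fresh_notin im; rewrite -e sim.
Qed.

(** This is absence of capture in semantic form: [sigma] sends no free variable of [phi] other than
    [x] to [z], so giving [z] the value [d] affects [x] alone. *)
Lemma upd_binder (g : var -> D) (sigma : var -> var) x phi d :
  let z := binder sigma x phi in
  {in fv phi, upd g z d \o upd sigma x z =1 upd (g \o sigma) x d}.
Proof.
move=> z y ya; rewrite /upd /=; case: (y =P x) => [_|/eqP yx]; first by rewrite eqxx.
by rewrite (negbTE (binder_avoids sigma ya yx)).
Qed.

Lemma forces_rename V phi X g sigma :
  forces V X g (rename sigma phi) <-> forces V X (g \o sigma) phi.
Proof.
elim: phi X g sigma => //=.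
- by move=> P xs X g sigma; rewrite map_comp.
- move=> a IHa b IHb X g sigma.
  by split=> ab Y YX; move: (ab Y YX); rewrite IHa IHb.
- by move=> a IHa b IHb X g sigma; rewrite IHa IHb.
- by move=> a IHa b IHb X g sigma; rewrite IHa IHb.
- move=> x a IHa X g sigma; split=> fa d; move: (fa d).
    by rewrite IHa; apply: forces_eq_on; apply: upd_binder.
  rewrite IHa; apply: forces_eq_on => y ya; symmetry; exact: upd_binder.
- move=> x a IHa X g sigma; split=> [] [d fa]; exists d; move: fa.
    by rewrite IHa; apply: forces_eq_on; apply: upd_binder.
  rewrite IHa; apply: forces_eq_on => y ya; symmetry; exact: upd_binder.
Qed.

Lemma forces_subst1 V phi X g x z :
  forces V X g (subst1 phi x z) <-> forces V X (upd g x (g z)) phi.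
Proof.
rewrite forces_rename; split; apply: forces_eq_on => y _;
  by rewrite /upd /=; case: eqP.
Qed.

Lemma fv_sub_vars phi : (fv phi `<=` vars phi)%fset.
Proof.
elim: phi => //=.
- by move=> a IHa b IHb; apply: fsetUSS.
- by move=> a IHa b IHb; apply: fsetUSS.
- by move=> a IHa b IHb; apply: fsetUSS.
- move=> x a IHa; apply/fsubsetP => y; rewrite !inE.
  by case/andP=> _ /(fsubsetP IHa)->; rewrite orbT.
- move=> x a IHa; apply/fsubsetP => y; rewrite !inE.
  by case/andP=> _ /(fsubsetP IHa)->; rewrite orbT.
Qed.

Lemma forces_upd_notin V phi X g z d :
  z \notin vars phi -> forces V X (upd g z d) phi <-> forces V X g phi.
Proof.
move=> zphi; split; apply: forces_eq_on => y yphi; rewrite /upd.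
all: case: eqP => // yz; case/negP: zphi.
all: by rewrite -yz (fsubsetP (fv_sub_vars phi)).
Qed.

(** The arguments [ds] are assigned to [ys] in order. Variables outside [ys] get the default from
    [nth]; under [lists_fv] they are not free in [psi]. *)
Definition val_subst V (P : S) (ys : seq var) psi d0 :
    S -> label -> seq D -> Prop :=
  fun Q X ds => if Q == P then forces V X (fun y => nth d0 ds (index y ys)) psi
                else V Q X ds.

Lemma val_subst_persistent V (P : S) ys psi d0 :
  persistent V -> persistent (val_subst V P ys psi d0).
Proof.
move=> pV Q X Y ds YX; rewrite /val_subst; case: eqP => _; last exact: pV.
exact: forces_persistent.
Qed.

(** [psubst] keeps the binders of [phi]. This is harmless because all free variables of [psi] are in
    [ys], so an instance of [psi] depends only on the values of the arguments of [P]. *)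
Lemma forces_psubst V (P : S) (ys : (arity P).-tuple var) psi d0 phi X g :
  lists_fv ys psi ->
  forces V X g (psubst ys psi phi) <-> forces (val_subst V P ys psi d0) X g phi.
Proof.
move=> [_ fvpsi]; elim: phi X g => //=.
- move=> Q xs X g; rewrite /val_subst; case: eqP => //= eQP.
  have szxs : size xs = size ys by rewrite !size_tuple eQP.
  have E y : y \in fv psi ->
      nth d0 (map g xs) (index y ys) = g (nth y xs (index y ys)).
    by rewrite -fvpsi !inE => yys; rewrite (nth_map y) // szxs index_mem.
  by rewrite forces_rename; split; apply: forces_eq_on => y /E /= ->.
- move=> a IHa b IHb X g.
  by split=> ab Y YX; move: (ab Y YX); rewrite IHa IHb.
- by move=> a IHa b IHb X g; rewrite IHa IHb.
- by move=> a IHa b IHb X g; rewrite IHa IHb.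
- by move=> x a IHa X g; split=> fa d; move: (fa d); rewrite IHa.
- by move=> x a IHa X g; split=> [] [d fa]; exists d; move: fa; rewrite IHa.
Qed.

End FixedDomain.

Definition refutes (D : Type) (V : S -> label -> seq D -> Prop) (g : var -> D)
    (Gamma Delta : {mset lformula S}) : Prop :=
  (forall L, L \in Gamma -> forces V L.1 g L.2) /\
  (forall L, L \in Delta -> ~ forces V L.1 g L.2).

Definition valid (Gamma Delta : {mset lformula S}) : Prop :=
  forall (D : Type) (V : S -> label -> seq D -> Prop) (g : var -> D),
  persistent V -> ~ refutes V g Gamma Delta.

Lemma valid_psubst (P : S) (ys : (arity P).-tuple var) psi Gamma Delta :
  lists_fv ys psi -> valid Gamma Delta ->
  valid (psubst_mset ys psi Gamma) (psubst_mset ys psi Delta).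
Proof.
move=> ysP vGD D V g pV [GV DV].
have mem_psubst (A : {mset lformula S}) L : L \in A ->
    (L.1, psubst ys psi L.2) \in psubst_mset ys psi A.
  move=> LA; rewrite /psubst_mset (perm_mem (perm_eq_seq_mset _)).
  by apply/mapP; exists L.
(* [g 0] serves as default element: the assignment witnesses that [D] is inhabited. *)
apply: (vGD D _ g (@val_subst_persistent _ V P ys psi (g 0) pV)).
split=> L LA; rewrite -forces_psubst //.
  exact: (GV _ (mem_psubst _ _ LA)).
exact: (DV _ (mem_psubst _ _ LA)).
Qed.

(** * Soundness for persistent valuations *)

Section Soundness.
Variables (D : Type) (V : S -> label -> seq D -> Prop).
Implicit Types (g : var -> D) (Gamma Delta : {mset lformula S}) (L : lformula S).

Lemma refutes_l g L Gamma Delta :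
  refutes V g (L +` Gamma) Delta <-> forces V L.1 g L.2 /\ refutes V g Gamma Delta.
Proof.
split=> [[GV DV]|[LV [GV DV]]]; last first.
  by split=> // L'; rewrite in_mset1D => /orP[/eqP->|/GV].
split; first by apply: GV; rewrite mset1D1.
by split=> // L' L'G; apply: GV; rewrite mset1Dr.
Qed.

Lemma refutes_r g L Gamma Delta :
  refutes V g Gamma (L +` Delta) <-> ~ forces V L.1 g L.2 /\ refutes V g Gamma Delta.
Proof.
split=> [[GV DV]|[LV [GV DV]]]; last first.
  by split=> // L'; rewrite in_mset1D => /orP[/eqP->|/DV].
split; first by apply: DV; rewrite mset1D1.
by split=> // L' L'G; apply: DV; rewrite mset1Dr.
Qed.

Lemma refutes_upd g z d Gamma Delta :
  not_in z Gamma -> not_in z Delta ->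
  refutes V g Gamma Delta -> refutes V (upd g z d) Gamma Delta.
Proof.
move=> zG zD [GV DV]; split=> L LA; rewrite forces_upd_notin; auto.
Qed.

Lemma not_in_cons z L (A : {mset lformula S}) :
  not_in z (L +` A) -> z \notin vars L.2 /\ not_in z A.
Proof.
move=> zA; split; first by apply: zA; rewrite mset1D1.
by move=> L' L'A; apply: zA; rewrite mset1Dr.
Qed.

(** With [refutes_upd], this handles eigenvariables: [z] can be given any value [d] without
    disturbing the rest of the sequent, and then names [d] in the premise. *)
Lemma forces_subst1_eigen X phi g x z d :
  z \notin (x |` vars phi)%fset ->
  forces V X (upd g z d) (subst1 phi x z) <-> forces V X (upd g x d) phi.
Proof.
rewrite !inE negb_or => /andP[zx zphi]; rewrite forces_subst1.
split; apply: forces_eq_on => y yphi; rewrite /upd eqxx; case: eqP => //.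
all: case: eqP => // yz; case/negP: zphi.
all: by rewrite -yz (fsubsetP (fv_sub_vars phi)).
Qed.

End Soundness.

Lemma soundness Gamma Delta : derivable_without_at Gamma Delta -> valid Gamma Delta.
Proof.
rewrite /derivable_without_at => der D V g pV; elim: Gamma Delta / der g.
- move=> G Dl X Y P xs YX g; rewrite refutes_l refutes_r /= => -[XV [YV _]].
  by apply: YV; apply: pV XV.
- by move=> G Dl X g; rewrite refutes_l => -[].
(* The rule (=> at) is barred by its flag. It would be unsound here, since a persistent valuation
   need not be determined by singleton labels. *)
- by [].
- move=> G Dl X a b _ IHa _ IHb g; rewrite refutes_r /= => -[nab GD].
  have [fa|na] := classic (forces V X g a); last by apply: (IHa g); rewrite refutes_r.
  by apply: (IHb g); rewrite refutes_r; split=> // fb; apply: nab.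
- move=> G Dl X a b _ IH g; rewrite refutes_l /= => -[[fa fb] GD].
  by apply: (IH g); rewrite !refutes_l.
- move=> G Dl X a b _ IH g; rewrite refutes_r /= => -[nab GD].
  apply: (IH g); rewrite !refutes_r; split=> [fa|]; first by apply: nab; left.
  by split=> // fb; apply: nab; right.
- move=> G Dl X a b _ IHa _ IHb g; rewrite refutes_l /= => -[[fa|fb] GD].
    by apply: (IHa g); rewrite refutes_l.
  by apply: (IHb g); rewrite refutes_l.
- move=> G Dl X a b _ IH g; rewrite refutes_r /= => -[nab GD].
  apply: nab => Y YX fa; apply: NNPP => nb.
  by apply: (IH Y YX g); rewrite refutes_l refutes_r.
- move=> G Dl X Y a b YX _ IHa _ IHb g GD.
  have := GD; rewrite refutes_l /= => -[ab _].
  have [fa|na] := classic (forces V Y g a).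
    by apply: (IHb g); rewrite refutes_l; split=> //; apply: ab.
  by apply: (IHa g); rewrite refutes_r.
- move=> G Dl X x z a zG zD _ IH g; rewrite refutes_r /= => -[na GD].
  apply: na => d; apply: NNPP => na; have [za zDl] := not_in_cons zD.
  apply: (IH (upd g z d)); rewrite refutes_r /= forces_subst1_eigen //.
  by split=> //; apply: refutes_upd.
- move=> G Dl X x y a _ IH g GD; apply: (IH g); rewrite refutes_l; split=> //=.
  by rewrite forces_subst1; move: GD; rewrite refutes_l => -[fa _]; apply: fa.
- move=> G Dl X x y a _ IH g; rewrite refutes_r /= => -[na GD].
  apply: (IH g); rewrite !refutes_r; split=> //=; split=> //=.
  by rewrite forces_subst1 => fa; apply: na; eexists; exact: fa.
- move=> G Dl X x z a zG zD _ IH g; rewrite refutes_l /= => -[[d fa] GD].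
  have [za zG'] := not_in_cons zG.
  apply: (IH (upd g z d)); rewrite refutes_l /= forces_subst1_eigen //.
  by split=> //; apply: refutes_upd.
Qed.

End Forcing.

(** * Completeness *)

Section Completeness.
Variable S : signature.
Implicit Types (phi psi : formula S) (X Y : label) (L : lformula S).
Implicit Types (Gamma Delta : {mset lformula S}) (G D : lformula S -> Prop).

(* [Y] and [y] are the instance requested in the rules that keep their principal
   formula; they are irrelevant to the others, which must be expanded only once. *)
Definition expanded_l G D L Y (y : var) : Prop :=
  let X := L.1 in
  match L.2 with
  | Atom _ _ => G L
  | Bot => False
  | Imp a b => (Y `<=` X)%fset -> D (Y, a) \/ G (Y, b)
  | Conj a b => G (X, a) /\ G (X, b)
  | IDisj a b => G (X, a) \/ G (X, b)
  | All x a => G (X, subst1 a x y)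
  | IEx x a => exists z, G (X, subst1 a x z)
  end.

Definition expanded_r G D L (y : var) : Prop :=
  let X := L.1 in
  match L.2 with
  | Atom _ _ => D L
  | Bot => True
  | Imp a b => exists Y : label, [/\ (Y `<=` X)%fset, G (Y, a) & D (Y, b)]
  | Conj a b => D (X, a) \/ D (X, b)
  | IDisj a b => D (X, a) /\ D (X, b)
  | All x a => exists z, D (X, subst1 a x z)
  | IEx x a => D (X, subst1 a x y)
  end.

Lemma expanded_l_mono G D G' D' L Y y :
  (forall L, G L -> G' L) -> (forall L, D L -> D' L) ->
  expanded_l G D L Y y -> expanded_l G' D' L Y y.
Proof.
move=> GG DD; case: L => X []; rewrite /expanded_l /=; auto.
- by move=> a b ab YX; case: (ab YX); auto.
- by move=> a b []; auto.
- by move=> a b []; auto.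
- by move=> x a [z]; eauto.
Qed.

Lemma expanded_r_mono G D G' D' L y :
  (forall L, G L -> G' L) -> (forall L, D L -> D' L) ->
  expanded_r G D L y -> expanded_r G' D' L y.
Proof.
move=> GG DD; case: L => X []; rewrite /expanded_r /=; auto.
- by move=> a b [Y [? ? ?]]; exists Y; split; auto.
- by move=> a b []; auto.
- by move=> a b []; auto.
- by move=> x a [z]; eauto.
Qed.

(** * One step of the proof search *)

Definition members Gamma L : Prop := L \in Gamma.

(** A formula may disappear only once it is expanded for all instances at the same time, so dropping
    it loses no later demand. *)
Definition progress (s t : {mset lformula S} * {mset lformula S}) : Prop :=
  (forall L, L \in s.1 ->
     L \in t.1 \/ forall Y y, expanded_l (members t.1) (members t.2) L Y y) /\
  (forall L, L \in s.2 ->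
     L \in t.2 \/ forall y, expanded_r (members t.1) (members t.2) L y).

Lemma progress_sub Gamma Delta Gamma' Delta' :
  {subset Gamma <= Gamma'} -> {subset Delta <= Delta'} ->
  progress (Gamma, Delta) (Gamma', Delta').
Proof. by move=> GG DD; split=> L LA; left; [apply: GG|apply: DD]. Qed.

Lemma progress_l Gamma Delta L Gamma' Delta' :
  {subset Gamma <= Gamma'} -> {subset Delta <= Delta'} ->
  (forall Y y, expanded_l (members Gamma') (members Delta') L Y y) ->
  progress (L +` Gamma, Delta) (Gamma', Delta').
Proof.
move=> GG DD LE; split=> L' /=; last by move/DD; left.
by rewrite in_mset1D => /orP[/eqP->|/GG]; auto.
Qed.

Lemma progress_r Gamma Delta L Gamma' Delta' :
  {subset Gamma <= Gamma'} -> {subset Delta <= Delta'} ->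
  (forall y, expanded_r (members Gamma') (members Delta') L y) ->
  progress (Gamma, L +` Delta) (Gamma', Delta').
Proof.
move=> GG DD LE; split=> L' /=; first by move/GG; left.
by rewrite in_mset1D => /orP[/eqP->|/DD]; auto.
Qed.

Lemma not_in_large Gamma : exists m, forall z, m < z -> not_in z Gamma.
Proof.
exists (\max_(L <- Gamma) \max_(x <- vars L.2) x) => z mz L LG.
apply/negP => zL; move: mz; rewrite ltnNge => /negP; apply.
apply: (leq_trans (n := \max_(x <- vars L.2) x)).
  exact: (@leq_bigmax_seq _ _ xpredT id _ zL isT).
exact: (@leq_bigmax_seq _ _ xpredT (fun L : lformula S => \max_(x <- vars L.2) x) _ LG isT).
Qed.

Lemma exists_eigenvariable Gamma Delta :
  exists z, not_in z Gamma /\ not_in z Delta.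
Proof.
have [m mG] := not_in_large Gamma; have [k kD] := not_in_large Delta.
exists (m + k).+1; split; [apply: mG|apply: kD]; first by rewrite ltnS leq_addr.
by rewrite ltnS leq_addl.
Qed.

Definition underivable (s : {mset lformula S} * {mset lformula S}) : Prop :=
  ~ derivable_without_at s.1 s.2.

Lemma subset_cons L Gamma : {subset Gamma <= L +` Gamma}.
Proof. by move=> L' L'G; rewrite mset1Dr. Qed.

Lemma subset_cons2 L L' Gamma : {subset Gamma <= L +` (L' +` Gamma)}.
Proof. by move=> K KG; rewrite !mset1Dr. Qed.

#[local] Hint Resolve subset_cons subset_cons2 : core.

(** If the conclusion of a rule is underivable, so is one of its premises; that premise is taken as
    [t]. When the rule keeps its principal formula, the sequent only grows. *)
Lemma expand_l Gamma Delta L Y y :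
  underivable (Gamma, Delta) -> L \in Gamma ->
  exists t, [/\ underivable t, progress (Gamma, Delta) t &
                expanded_l (members t.1) (members t.2) L Y y].
Proof.
move=> + LG; rewrite -(msetB1K LG); move: (Gamma `\ L)%mset => {LG}Gamma nder.
case: L nder => X [P xs||a b|a b|a b|x a|x a]; rewrite /underivable /= => nder.
- exists ((X, Atom xs) +` Gamma, Delta); split=> //; first exact: progress_sub.
  exact: mset1D1.
- by case: nder; apply: ax_bot.
- have [YX|/negP YX] := boolP (Y `<=` X)%fset; last first.
    by exists ((X, Imp a b) +` Gamma, Delta); split=> //; apply: progress_sub.
  have [da|nda] := classic (derivable_without_at ((X, Imp a b) +` Gamma) ((Y, a) +` Delta)).
    have ndb : ~ derivable_without_at ((Y, b) +` ((X, Imp a b) +` Gamma)) Delta.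
      by move=> db; apply: nder; apply: rule_imp_l YX da db.
    exists ((Y, b) +` ((X, Imp a b) +` Gamma), Delta); split=> //.
      exact: progress_sub.
    by right; apply: mset1D1.
  exists ((X, Imp a b) +` Gamma, (Y, a) +` Delta); split=> //.
    exact: progress_sub.
  by left; apply: mset1D1.
- have E : (X, a) \in (X, a) +` ((X, b) +` Gamma) /\
           (X, b) \in (X, a) +` ((X, b) +` Gamma).
    by split; rewrite !in_mset1D eqxx ?orbT.
  exists ((X, a) +` ((X, b) +` Gamma), Delta); split=> //.
    by move=> d; apply: nder; apply: rule_and_l.
  exact: progress_l.
- have [da|nda] := classic (derivable_without_at ((X, a) +` Gamma) Delta).
    have ndb : ~ derivable_without_at ((X, b) +` Gamma) Delta.
      by move=> db; apply: nder; apply: rule_or_l.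
    have E : (X, b) \in (X, b) +` Gamma by apply: mset1D1.
    exists ((X, b) +` Gamma, Delta); split; [exact: ndb| |by right].
    by apply: progress_l => // Y' y'; right.
  have E : (X, a) \in (X, a) +` Gamma by apply: mset1D1.
  exists ((X, a) +` Gamma, Delta); split; [exact: nda| |by left].
  by apply: progress_l => // Y' y'; left.
- exists ((X, subst1 a x y) +` ((X, All x a) +` Gamma), Delta); split.
  + by move=> d; apply: nder; apply: rule_all_l d.
  + exact: progress_sub.
  + exact: mset1D1.
- have [z [zG zD]] := exists_eigenvariable ((X, IEx x a) +` Gamma) Delta.
  have E : (X, subst1 a x z) \in (X, subst1 a x z) +` Gamma by apply: mset1D1.
  exists ((X, subst1 a x z) +` Gamma, Delta); split; last by exists z.
    by move=> d; apply: nder; apply: rule_ex_l zG zD d.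
  by apply: progress_l => // Y' y'; exists z.
Qed.

Lemma expand_r Gamma Delta L y :
  underivable (Gamma, Delta) -> L \in Delta ->
  exists t, [/\ underivable t, progress (Gamma, Delta) t &
                expanded_r (members t.1) (members t.2) L y].
Proof.
move=> + LD; rewrite -(msetB1K LD); move: (Delta `\ L)%mset => {LD}Delta nder.
case: L nder => X [P xs||a b|a b|a b|x a|x a]; rewrite /underivable /= => nder.
- exists (Gamma, (X, Atom xs) +` Delta); split=> //; first exact: progress_sub.
  exact: mset1D1.
- by exists (Gamma, (X, Bot) +` Delta); split=> //; apply: progress_sub.
(* The rule has one premise for each label below [X]; classically, one of them is underivable. *)
- have [Y YX nd] : exists2 Y : label, (Y `<=` X)%fset &
      ~ derivable_without_at ((Y, a) +` Gamma) ((Y, b) +` Delta).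
    apply: NNPP => nE; apply: nder; apply: rule_imp_r => Y YX.
    by apply: NNPP => nd; apply: nE; exists Y.
  have E1 : (Y, a) \in (Y, a) +` Gamma by apply: mset1D1.
  have E2 : (Y, b) \in (Y, b) +` Delta by apply: mset1D1.
  exists ((Y, a) +` Gamma, (Y, b) +` Delta); split; [exact: nd| |by exists Y].
  by apply: progress_r => // y'; exists Y.
- have [da|nda] := classic (derivable_without_at Gamma ((X, a) +` Delta)).
    have ndb : ~ derivable_without_at Gamma ((X, b) +` Delta).
      by move=> db; apply: nder; apply: rule_and_r.
    have E : (X, b) \in (X, b) +` Delta by apply: mset1D1.
    exists (Gamma, (X, b) +` Delta); split; [exact: ndb| |by right].
    by apply: progress_r => // y'; right.
  have E : (X, a) \in (X, a) +` Delta by apply: mset1D1.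
  exists (Gamma, (X, a) +` Delta); split; [exact: nda| |by left].
  by apply: progress_r => // y'; left.
- have E : (X, a) \in (X, a) +` ((X, b) +` Delta) /\
           (X, b) \in (X, a) +` ((X, b) +` Delta).
    by split; rewrite !in_mset1D eqxx ?orbT.
  exists (Gamma, (X, a) +` ((X, b) +` Delta)); split=> //.
    by move=> d; apply: nder; apply: rule_or_r.
  exact: progress_r.
- have [z [zG zD]] := exists_eigenvariable Gamma ((X, All x a) +` Delta).
  have E : (X, subst1 a x z) \in (X, subst1 a x z) +` Delta by apply: mset1D1.
  exists (Gamma, (X, subst1 a x z) +` Delta); split; last by exists z.
    by move=> d; apply: nder; apply: rule_all_r zG zD d.
  by apply: progress_r => // y'; exists z.
- exists (Gamma, (X, IEx x a) +` ((X, subst1 a x y) +` Delta)); split.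
  + by move=> d; apply: nder; apply: rule_ex_r d.
  + by apply: progress_sub => // K; rewrite !in_mset1D => /orP[->|->]; rewrite ?orbT.
  + by apply: mset1Dr; apply: mset1D1.
Qed.

(** * Fair iteration of the search *)

Definition task : Type := bool * (label * formula S) * label * var.

(** [true] marks the left-hand side. [None] stands for a number that codes no task and demands
    nothing. *)
Definition fulfils (s t : {mset lformula S} * {mset lformula S}) (T : option task) :=
  match T with
  | Some (true, L, Y, y) => L \in s.1 -> expanded_l (members t.1) (members t.2) L Y y
  | Some (false, L, Y, y) => L \in s.2 -> expanded_r (members t.1) (members t.2) L y
  | None => True
  end.

Lemma next_exists (s : sig underivable) (T : option task) :
  exists t : sig underivable,
    progress (sval s) (sval t) /\ fulfils (sval s) (sval t) T.
Proof.
have stay : progress (sval s) (sval s) by case: (sval s) => ? ?; apply: progress_sub.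
case: T => [[[[[|] L] Y] y]|]; last by exists s.
  have [LA|/negP LA] := boolP (L \in (sval s).1); last by exists s; split=> // /LA.
  case: s LA {stay} => -[Gamma Delta] nder LA.
  have [t [nt pt et]] := expand_l Y y nder LA.
  by exists (exist _ t nt); split=> [|_]; [exact: pt|exact: et].
have [LA|/negP LA] := boolP (L \in (sval s).2); last by exists s; split=> // /LA.
case: s LA {stay} => -[Gamma Delta] nder LA.
have [t [nt pt et]] := expand_r y nder LA.
by exists (exist _ t nt); split=> [|_]; [exact: pt|exact: et].
Qed.

(* The second component of the code makes every task recur infinitely often. *)
Definition task_at (n : nat) : option task :=
  omap fst (choice.unpickle n : option (task * nat)).

Lemma task_recurs (T : task) m : exists2 n, m <= n & task_at n = Some T.
Proof.
pose f (k : nat) := choice.pickle (T, k).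
have f_inj : injective f by move=> i j /(pcan_inj choice.pickleK) [].
have [k mk] : exists k, m <= f k.
  apply: NNPP => small.
  (* Pigeonhole: the injective [f] cannot map [m.+1] numbers below [m]. *)
  have sub : {subset [seq f k | k <- iota 0 m.+1] <= iota 0 m}.
    move=> _ /mapP[k _ ->]; rewrite mem_iota /= ltnNge; apply/negP => mk.
    by apply: small; exists k.
  have := uniq_leq_size _ sub; rewrite map_inj_uniq // iota_uniq.
  by move/(_ isT); rewrite size_map !size_iota ltnn.
by exists (f k) => //; rewrite /task_at /f choice.pickleK.
Qed.

Definition next (s : sig underivable) (T : option task) : sig underivable :=
  proj1_sig (constructive_indefinite_description _ (next_exists s T)).

Fixpoint search (s : sig underivable) (n : nat) : sig underivable :=
  if n is m.+1 then next (search s m) (task_at m) else s.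

Definition reached_l s L : Prop := exists n, L \in (sval (search s n)).1.
Definition reached_r s L : Prop := exists n, L \in (sval (search s n)).2.

Lemma search_step s n :
  progress (sval (search s n)) (sval (search s n.+1)) /\
  fulfils (sval (search s n)) (sval (search s n.+1)) (task_at n).
Proof. by rewrite /= /next; case: constructive_indefinite_description. Qed.

(** By [progress], the step at which [L] disappears expands it for every instance, and expansions
    persist in the limit by monotonicity. *)
Lemma search_keep_l s m n L : m <= n -> L \in (sval (search s m)).1 ->
  L \in (sval (search s n)).1 \/
  forall Y y, expanded_l (reached_l s) (reached_r s) L Y y.
Proof.
move=> mn Lm; elim: n mn => [|n IH]; first by rewrite leqn0 => /eqP <-; left.
rewrite leq_eqVlt => /orP[/eqP <-|/IH [Ln|]]; [by left| |by right].
have [[pl _] _] := search_step s n; case: (pl L Ln) => [|E]; first by left.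
by right=> Y y; apply: expanded_l_mono (E Y y) => K Kn; exists n.+1.
Qed.

Lemma search_keep_r s m n L : m <= n -> L \in (sval (search s m)).2 ->
  L \in (sval (search s n)).2 \/
  forall y, expanded_r (reached_l s) (reached_r s) L y.
Proof.
move=> mn Lm; elim: n mn => [|n IH]; first by rewrite leqn0 => /eqP <-; left.
rewrite leq_eqVlt => /orP[/eqP <-|/IH [Ln|]]; [by left| |by right].
have [[_ pr] _] := search_step s n; case: (pr L Ln) => [|E]; first by left.
by right=> y; apply: expanded_r_mono (E y) => K Kn; exists n.+1.
Qed.

(** Atoms never disappear: for an atom, being expanded means being present, so both alternatives of
    [progress] give membership. *)
Lemma search_atom_l s m n X (P : S) (xs : (arity P).-tuple var) : m <= n ->
  (X, Atom xs) \in (sval (search s m)).1 -> (X, Atom xs) \in (sval (search s n)).1.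
Proof.
move=> mn Lm; elim: n mn => [|n IH]; first by rewrite leqn0 => /eqP <-.
rewrite leq_eqVlt => /orP[/eqP <-//|/IH Ln].
by have [[pl _] _] := search_step s n; case: (pl _ Ln) => // /(_ X 0).
Qed.

Lemma search_atom_r s m n X (P : S) (xs : (arity P).-tuple var) : m <= n ->
  (X, Atom xs) \in (sval (search s m)).2 -> (X, Atom xs) \in (sval (search s n)).2.
Proof.
move=> mn Lm; elim: n mn => [|n IH]; first by rewrite leqn0 => /eqP <-.
rewrite leq_eqVlt => /orP[/eqP <-//|/IH Ln].
by have [[_ pr] _] := search_step s n; case: (pr _ Ln) => // /(_ 0).
Qed.

(** The task for this instance recurs after [L] appears. Either [L] is still there and the task
    expands it, or it was consumed earlier and all its instances were expanded then. *)
Lemma reached_expanded_l s L Y y :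
  reached_l s L -> expanded_l (reached_l s) (reached_r s) L Y y.
Proof.
move=> [m Lm]; have [n mn Tn] := task_recurs (true, L, Y, y) m.
case: (search_keep_l mn Lm) => // Ln; have [_] := search_step s n.
rewrite Tn => /(_ Ln); apply: expanded_l_mono => K Kn; by exists n.+1.
Qed.

Lemma reached_expanded_r s L y :
  reached_r s L -> expanded_r (reached_l s) (reached_r s) L y.
Proof.
(* [L.1] is a dummy: right-hand tasks request no label. *)
move=> [m Lm]; have [n mn Tn] := task_recurs (false, L, L.1, y) m.
case: (search_keep_r mn Lm) => // Ln; have [_] := search_step s n.
rewrite Tn => /(_ Ln); apply: expanded_r_mono => K Kn; by exists n.+1.
Qed.

(** Both atoms would survive to stage [maxn m n], whose sequent would then be an instance of
    [ax_id], although every stage is underivable. *)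
Lemma reached_consistent s X Y (P : S) (xs : (arity P).-tuple var) :
  (Y `<=` X)%fset -> reached_l s (X, Atom xs) -> ~ reached_r s (Y, Atom xs).
Proof.
move=> YX [m Lm] [n Ln].
have := search_atom_r (leq_maxr m n) Ln; have := search_atom_l (leq_maxl m n) Lm.
case: (search s (maxn m n)) => -[Gamma Delta] nder /= LG LD; apply: nder => /=.
by rewrite -(msetB1K LG) -(msetB1K LD); apply: ax_id.
Qed.

(** The individuals are the variables themselves. Closing the reached left-hand atoms under smaller
    labels makes the valuation persistent. *)
Definition canonical_val s (P : S) X (ds : seq var) : Prop :=
  exists Y (xs : (arity P).-tuple var),
    [/\ (X `<=` Y)%fset, ds = xs & reached_l s (Y, Atom xs)].

Lemma canonical_val_persistent s : persistent (canonical_val s).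
Proof.
move=> P X Y ds YX [Z [xs [XZ -> GZ]]]; exists Z, xs; split=> //.
exact: fsubset_trans XZ.
Qed.

(** * Truth in the canonical model *)

Fixpoint depth phi : nat :=
  match phi with
  | Atom _ _ | Bot => 0
  | Imp a b | Conj a b | IDisj a b => (maxn (depth a) (depth b)).+1
  | All _ a | IEx _ a => (depth a).+1
  end.

Lemma depth_rename sigma phi : depth (rename sigma phi) = depth phi.
Proof.
by elim: phi sigma => //= [a IHa b IHb|a IHa b IHb|a IHa b IHb|x a IHa|x a IHa] sigma;
  rewrite ?IHa ?IHb.
Qed.

(** The induction is on [depth], since the instance [subst1 a x y] is not a subformula of a
    quantified formula but has the depth of [a]. Under [id] each variable denotes itself, so
    instances by variables exhaust the domain. *)
Lemma truth s phi X :
  (reached_l s (X, phi) -> forces (canonical_val s) X id phi) /\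
  (reached_r s (X, phi) -> ~ forces (canonical_val s) X id phi).
Proof.
have [k] := ubnP (depth phi); elim: k phi X => // k IH phi X.
have E Y y := @reached_expanded_l s (X, phi) Y y.
have F y := @reached_expanded_r s (X, phi) y.
have Esub x y a : depth a < k ->
    (reached_l s (X, subst1 a x y) ->
       forces (canonical_val s) X (upd id x y) a) /\
    (reached_r s (X, subst1 a x y) ->
       ~ forces (canonical_val s) X (upd id x y) a).
  move=> ka; have := IH (subst1 a x y) X; rewrite depth_rename => /(_ ka).
  by rewrite forces_subst1.
case: phi E F => /= [P xs||a b|a b|a b|x a|x a] E F; rewrite ltnS ?gtn_max => kphi.
- rewrite map_id; split=> [LG|LD [Y [ys [XY xys LG]]]]; first by exists X, xs.
  by move/val_inj: xys LG => <- LG; apply: reached_consistent XY LG LD.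
- by split=> [LG|_ //]; apply: (E X 0 LG).
- case/andP: kphi => ka kb; split=> [LG Y YX fa|LD fab].
    case: (E Y 0 LG YX) => [Da|Gb]; first by case: (proj2 (IH a Y ka) Da).
    exact: (proj1 (IH b Y kb) Gb).
  have [Y [YX Ga Db]] := F 0 LD; apply: (proj2 (IH b Y kb) Db).
  by apply: fab YX _; apply: (proj1 (IH a Y ka) Ga).
- case/andP: kphi => ka kb; have [A1 A2] := IH a X ka; have [B1 B2] := IH b X kb.
  split=> [LG|LD [fa fb]]; first by have [] := E X 0 LG; auto.
  by case: (F 0 LD) => [/A2|/B2].
- case/andP: kphi => ka kb; have [A1 A2] := IH a X ka; have [B1 B2] := IH b X kb.
  split=> [LG|LD f]; first by case: (E X 0 LG); auto.
  by have [/A2 ? /B2 ?] := F 0 LD; case: f.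
- split=> [LG d|LD fa]; first by apply: (proj1 (Esub x d a kphi)); apply: (E X d LG).
  by have [z /(proj2 (Esub x z a kphi))] := F 0 LD; apply; apply: fa.
- split=> [LG|LD [d fa]].
    by have [z /(proj1 (Esub x z a kphi))] := E X 0 LG; exists z.
  by have /(proj2 (Esub x d a kphi)) := F d LD; apply.
Qed.

Lemma completeness Gamma Delta : valid Gamma Delta -> derivable_without_at Gamma Delta.
Proof.
move=> vGD; apply: NNPP => nder.
pose s : sig underivable := exist _ (Gamma, Delta) nder.
apply: (vGD _ (canonical_val s) id (canonical_val_persistent (s := s))).
by split=> -[X phi] LA; have [T1 T2] := truth s phi X; [apply: T1|apply: T2]; exists 0.
Qed.

End Completeness.

(** * Information states as labels *)

Section InformationStates.
Variables (S : signature) (M : model S).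
Implicit Types (phi : formula S) (X Y : label).
Implicit Types (s t : world M -> Prop) (g : var -> indiv M).

Lemma supports_subset phi s t g :
  (forall w, t w -> s w) -> supports s g phi -> supports t g phi.
Proof.
elim: phi s t g => //=.
- by move=> P xs s t g ts sP w /ts; apply: sP.
- by move=> s t g ts s0 w /ts; apply: s0.
- by move=> a _ b _ s t g ts ab u ut; apply: ab => w /ut /ts.
- by move=> a IHa b IHb s t g ts [sa sb]; split; eauto.
- by move=> a IHa b IHb s t g ts [sa|sb]; [left|right]; eauto.
- by move=> x a IHa s t g ts sa d; eauto.
- by move=> x a IHa s t g ts [d sa]; exists d; eauto.
Qed.

(** Labels are nonempty, so the empty state has no label and needs separate treatment. *)
Lemma supports_empty phi s g : (forall w, ~ s w) -> supports s g phi.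
Proof.
elim: phi s g => //=.
- by move=> P xs s g s0 w /s0.
- by move=> a _ b IHb s g s0 t ts _; apply: IHb => w /ts /s0.
- by move=> a IHa b IHb s g s0; split; auto.
- by move=> a IHa b _ s g s0; left; auto.
- by move=> x a IHa s g s0 d; auto.
- by move=> x a IHa s g s0; exists (g 0); auto.
Qed.

Variable h : nat -> world M.

Definition state_of (A : {fset nat}) (w : world M) : Prop :=
  exists2 k, k \in A & h k = w.

Lemma state_of_subset (A B : {fset nat}) w :
  (A `<=` B)%fset -> state_of A w -> state_of B w.
Proof. by move=> AB [k kA hk]; exists k => //; apply: (fsubsetP AB). Qed.

(* [ds] is a mere sequence, hence the quantification over the unique tuple it
   underlies. *)
Definition state_val (P : S) X (ds : seq (indiv M)) : Prop :=
  forall k, k \in lset X -> forall xs : (arity P).-tuple (indiv M),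
  tval xs = ds -> interp (h k) xs.

Lemma state_val_persistent : persistent state_val.
Proof. by move=> P X Y ds YX XP k kY; apply: XP; apply: (fsubsetP YX). Qed.

(* A nonempty substate of [state_of X] is [state_of Y] for a label [Y] contained
   in [X], and the empty one supports everything, so quantifying over labels
   amounts to quantifying over states. *)
Lemma forces_supports phi X g :
  forces state_val X g phi <-> supports (state_of X) g phi.
Proof.
elim: phi X g => /= [P xs|| a IHa b IHb|a IHa b IHb|a IHa b IHb|x a IHa|x a IHa] X g.
- split=> [XP w [k kX <-]|XP k kX ds dsE]; first exact: XP.
  by rewrite (val_inj (dsE : val ds = val (map_tuple g xs))); apply: XP; exists k.
- split=> // X0; have [k kX] := fset0Pn _ (lset_neq0 X).
  by apply: (X0 (h k)); exists k.
- split=> [ab t tX ta|ab Y YX]; last first.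
    by rewrite IHa IHb; apply: ab => w; apply: state_of_subset.
  have [[w tw]|t0] := classic (exists w, t w); last first.
    by apply: supports_empty => w tw; apply: t0; exists w.
  (* Carving a finite set out of [X] takes a boolean predicate, while [t] is an arbitrary one. *)
  pose th k : bool := if excluded_middle_informative (t (h k)) then true else false.
  have thP k : th k <-> t (h k).
    by rewrite /th; case: excluded_middle_informative.
  pose A := [fset k in lset X | th k]%fset.
  have AE v : state_of A v <-> t v.
    split=> [[k] |tv]; first by rewrite !inE => /andP[_ /thP tk] <-.
    have [k kX hk] := tX v tv; exists k => //; rewrite !inE kX.
    by apply/thP; rewrite hk.
  have A0 : A != fset0 by have [k kA _] := (AE w).2 tw; apply/fset0Pn; exists k.
  have AX : (A `<=` X)%fset by apply/fsubsetP => k; rewrite !inE => /andP[].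
  apply: (@supports_subset b (state_of A)) => [v /AE //|].
  apply/(IHb (Label A0)); apply: ab => //.
  by apply/(IHa (Label A0)); apply: supports_subset ta => v /AE.
- by rewrite IHa IHb.
- by rewrite IHa IHb.
- by split=> fa d; move: (fa d); rewrite IHa.
- by split=> [] [d fa]; exists d; move: fa; rewrite IHa.
Qed.

End InformationStates.

(** * From derivability to schematic validity *)

Section SchematicValidity.
Variable S : signature.
Implicit Types phi : formula S.

Lemma derivable_InqBQ n (n_gt0 : 0 < n) phi :
  derivable_without_at mset0 [mset (initial_label n_gt0, phi)] -> InqBQ n phi.
Proof.
move=> /soundness val_phi M [f f_inj] s g.
have [[w0 sw0]|s0] := classic (exists w, s w); last first.
  by apply: supports_empty => w sw; apply: s0; exists w.
(* World [v] of [s] gets number [(f v).+1], as [f] counts from 0 and the label from 1. Numbers of no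
   world in [s] may name any world of [s]; [w0] shows that one exists. *)
pose R k w := s w /\ forall v, s v -> (f v).+1 = k -> v = w.
have R_ex k : exists w, R k w.
  have [[w [sw fw]]|nw] := classic (exists w, s w /\ (f w).+1 = k).
    by exists w; split=> // v _; rewrite -fw => -[] /val_inj /f_inj.
  by exists w0; split=> // v sv fv; case: nw; exists v.
pose h k := epsilon (inhabits w0) (R k).
have hR k : R k (h k) := epsilon_spec (inhabits w0) (R k) (R_ex k).
have fX : forces (state_val h) (initial_label n_gt0) g phi.
  apply: NNPP => nfX; apply: (val_phi _ (state_val h) g).
    exact: state_val_persistent.
  by split=> L; [rewrite in_mset0|rewrite in_mset1 => /eqP->].
(* It is enough that the worlds numbered by the label cover [s], since support passes to
   substates. *)
move/forces_supports: fX; apply: supports_subset => w sw.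
exists (f w).+1; last by rewrite -(proj2 (hR (f w).+1) w).
by rewrite !inE mem_iota /= add1n ltnS ltn_ord.
Qed.

Lemma psubst_mset0 (P : S) (ys : (arity P).-tuple var) psi :
  psubst_mset ys psi mset0 = mset0.
Proof. by rewrite /psubst_mset enum_mset0; apply/msetP => L; rewrite mset_seqE mset0E. Qed.

Lemma psubst_mset1 (P : S) (ys : (arity P).-tuple var) psi (L : lformula S) :
  psubst_mset ys psi [mset L] = [mset (L.1, psubst ys psi L.2)].
Proof.
rewrite /psubst_mset enum_msetn /=; apply/msetP => K.
by rewrite mset_seqE msetnE /= addn0 eq_sym; case: eqP.
Qed.

End SchematicValidity.

(** Going through validity avoids rewriting the derivation, where (id) would have to be derived for
    [psi] and eigenvariables might clash with variables of [psi]. *)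
Lemma derivable_psubst (S : signature) (P : S) (ys : (arity P).-tuple var)
    (psi : formula S) (Gamma Delta : {mset lformula S}) :
  lists_fv ys psi -> derivable_without_at Gamma Delta ->
  derivable_without_at (psubst_mset ys psi Gamma) (psubst_mset ys psi Delta).
Proof.
by move=> ysP /soundness GD; apply: completeness; apply: valid_psubst.
Qed.

Theorem theorem4 (S : signature) :
  (forall (P : S) (ys : (arity P).-tuple var) (psi : formula S),
     lists_fv ys psi ->
     forall Gamma Delta : {mset lformula S},
       derivable_without_at Gamma Delta ->
       derivable_without_at (psubst_mset ys psi Gamma) (psubst_mset ys psi Delta))
  /\
  (forall (n : nat) (n_ge1 : 1 <= n) (phi : formula S),
     derivable_without_at mset0 [mset (initial_label n_ge1, phi)] ->
     schematically_valid n phi).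
Proof.
split=> [P ys psi ysP Gamma Delta|n n_ge1 phi der chi chi_inst].
  exact: derivable_psubst.
(* What is carried along the successive substitutions is derivability, not membership in [InqBQ]. *)
apply: (derivable_InqBQ (n_gt0 := n_ge1)).
elim: {chi} chi_inst => [|chi P ys psi _ chi_der ysP]; first exact: der.
have := derivable_psubst ysP chi_der.
by rewrite psubst_mset0 psubst_mset1.
Qed.
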